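(* Let $q>0$, $q\neq 1$ be fixed, and let $m$ be any fixed positive integer. Then the function $$x\mapsto m(-1)^{m+1}\psi_q'(x)\psi_q^{(m)}(x)+(-1)^{m+1}\psi_q^{(m+1)}(x)-(-1)^{m+1}d_{m,q}\,\ln q\cdot\psi_q^{(m)}(x)$$ is completely monotonic on $(0,\infty)$, where $d_{m,q}=m-1$ if $0<q<1$ and $m\ge 2$, and $d_{m,q}=1$ if $q>1$ (any $m\ge 1$) or if $0<q<1$ and $m=1$.
   Context: A function $f$ is completely monotonic on an interval $(a,b)$ if it has derivatives of all orders there and $(-1)^k f^{(k)}(x)\ge 0$ for all $x\in(a,b)$ and all integers $k\ge 0$. For $x>0$ and $q>0$, $q\ne 1$, the $q$-gamma function is $$\Gamma_q(x)=(1-q)^{1-x}\prod_{n=0}^{\infty}\frac{1-q^{n+1}}{1-q^{n+x}}\quad (0<q<1),$$ $$\Gamma_q(x)=(q-1)^{1-x}q^{\frac12 x(x-1)}\prod_{n=0}^{\infty}\frac{1-q^{-(n+1)}}{1-q^{-(n+x)}}\quad (q>1).$$ Let $\psi_q(x)=\frac{d}{dx}\ln\Gamma_q(x)$ be its logarithmic derivative, and let $\psi_q^{(k)}$ ($k\ge 1$) be its $k$-th derivative. *)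

(* Defs.v *)
From Stdlib Require Import Reals Lra Lia.
From Coquelicot Require Import Coquelicot.
Open Scope R_scope.

(* Limit of the products of u 0, ..., u N: [Lim_seq] is total, and takes a
   conventional value when the partial products do not converge. *)
Definition infinite_prod (u : nat -> R) : R :=
  real (Lim_seq (fun N => prod_f_R0 u N)).

(* Only meaningful for x > 0, q > 0, q <> 1; [Derive] being local, the values
   for x <= 0 do not affect [q_psi] and its derivatives at points x > 0. *)
Definition q_Gamma (q x : R) : R :=
  if Rlt_dec q 1 then
    Rpower (1 - q) (1 - x) *
    infinite_prod (fun n => (1 - Rpower q (INR n + 1)) / (1 - Rpower q (INR n + x)))
  else
    Rpower (q - 1) (1 - x) * Rpower q (/ 2 * x * (x - 1)) *
    infinite_prod (fun n =>
      (1 - Rpower q (- (INR n + 1))) / (1 - Rpower q (- (INR n + x)))).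

Definition q_psi (q : R) : R -> R :=
  Derive (fun x => ln (q_Gamma q x)).

(* [ex_derive_n f k x] asks for the k-th derivative at x itself, so quantifying
   over all k and x says that f is smooth on the open interval (a, b). *)
Definition completely_monotonic (a b : Rbar) (f : R -> R) : Prop :=
  forall (k : nat) (x : R), Rbar_lt a x -> Rbar_lt x b ->
    ex_derive_n f k x /\ 0 <= (-1) ^ k * Derive_n f k x.

Definition d_coef (m : nat) (q : R) : R :=
  if Rlt_dec q 1 then (if (2 <=? m)%nat then INR m - 1 else 1) else 1.

(* Main.v *)
Require Import Defs.
From Stdlib Require Import Reals Lra Lia.
From Coquelicot Require Import Coquelicot.
Open Scope R_scope.

(** Put [p = min (q, 1/q)], [L = - ln p] and [y = p^x].  Up to a polynomial of
    degree at most two in [x], [ln (q_Gamma q x)] is the power series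
    [T y = sum_{n >= 1} y^n / (n (1 - p^n))], and differentiating in [x]
    multiplies the coefficient of [y^n] by [- n L].  With
    [c_n = 1 / (1 - p^n)] and [r = m - 1], the function of the theorem is
    [L^(m+2)] times the power series in [y] with coefficients
    [m L sum_{i+j=n} (i^m c_i) (j c_j) + e n^m c_n - n^(m+1) c_n], where
    [e = max (r, 1)]; for [q > 1] the linear
    term [x ln q] of [q_psi] turns the coefficient [1] of the statement into
    this same [e].  The coefficients are nonnegative because
    [L (i c_i) (j c_j) >= (i + j) c_(i+j)], which follows from
    [1 / (1 - exp (-a)) >= 1 / a + 1 / 2], and because
    [m sum_{0<j<n} j^r >= n^r (n - e)]. *)

(** * Power series that converge on the open unit disk *)

Definition conv_unit_disk (a : nat -> R) : Prop :=
  forall y, Rabs y < 1 -> ex_pseries a y.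

(** At the midpoint [r] between |y| and 1 the series converges, so its terms tend to zero there,
    which excludes a radius of convergence below [r]. *)
Lemma conv_unit_disk_radius a y :
  conv_unit_disk a -> Rabs y < 1 -> Rbar_lt (Rabs y) (CV_radius a).
Proof.
intros Ha Hy.
set (r := (Rabs y + 1) / 2).
pose proof (Rabs_pos y) as Hp.
assert (Hr : Rabs r = r) by (apply Rabs_pos_eq; unfold r; lra).
apply Rbar_lt_le_trans with r; [simpl; unfold r; lra|].
apply Rbar_not_lt_le; intros Hlt.
rewrite <- Hr in Hlt.
apply (CV_disk_outside _ _ Hlt).
apply ex_series_lim_0.
destruct (Ha r) as [l Hl]; [rewrite Hr; unfold r; lra|].
exists l; apply is_pseries_R, Hl.
Qed.

Lemma conv_unit_disk_of_radius a :
  (forall y, Rabs y < 1 -> Rbar_lt (Rabs y) (CV_radius a)) -> conv_unit_disk a.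
Proof. intros H y Hy; apply CV_radius_inside, H, Hy. Qed.

Lemma conv_unit_disk_ext a b :
  (forall n, a n = b n) -> conv_unit_disk a -> conv_unit_disk b.
Proof. intros E Ha y Hy; apply ex_pseries_ext with a; [exact E|apply Ha, Hy]. Qed.

Lemma conv_unit_disk_bounded a M :
  (forall n, Rabs (a n) <= M) -> conv_unit_disk a.
Proof.
intros H; apply conv_unit_disk_of_radius; intros y Hy.
apply Rbar_lt_le_trans with 1; [exact Hy|].
apply (proj1 (CV_radius_bounded a)).
exists M; intros n; rewrite pow1, Rmult_1_r; apply H.
Qed.

(** Coefficient form of the Euler operator y d/dy, which the substitution y = p^x turns into d/dx up
    to the factor [ln p]. *)
Lemma euler_PS (a : nat -> R) n : PS_incr_1 (PS_derive a) n = INR n * a n.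
Proof.
destruct n; [change (zero = 0 * a 0%nat); rewrite Rmult_0_l; reflexivity|reflexivity].
Qed.

Lemma conv_unit_disk_euler a :
  conv_unit_disk a -> conv_unit_disk (fun n => INR n * a n).
Proof.
intros Ha.
apply conv_unit_disk_ext with (1 := euler_PS a).
apply conv_unit_disk_of_radius; intros y Hy.
rewrite CV_radius_incr_1, CV_radius_derive.
now apply conv_unit_disk_radius.
Qed.

Lemma conv_unit_disk_scal c a :
  conv_unit_disk a -> conv_unit_disk (fun n => c * a n).
Proof.
intros Ha y Hy; apply (ex_pseries_scal c a y); [apply Rmult_comm|apply Ha, Hy].
Qed.

Lemma conv_unit_disk_plus a b :
  conv_unit_disk a -> conv_unit_disk b -> conv_unit_disk (fun n => a n + b n).
Proof.
intros Ha Hb y Hy; apply (ex_pseries_plus a b y); [apply Ha|apply Hb]; exact Hy.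
Qed.

Lemma conv_unit_disk_mult a b :
  conv_unit_disk a -> conv_unit_disk b -> conv_unit_disk (PS_mult a b).
Proof.
intros Ha Hb y Hy; apply ex_pseries_mult; now apply conv_unit_disk_radius.
Qed.

Lemma conv_unit_disk_euler_pow l k a :
  conv_unit_disk a -> conv_unit_disk (fun n => (l * INR n) ^ k * a n).
Proof.
intros Ha; induction k as [|k IH].
- apply conv_unit_disk_ext with a; [intros n; simpl; ring|exact Ha].
- apply conv_unit_disk_ext with
    (fun n => l * (INR n * ((l * INR n) ^ k * a n))); [intros n; simpl; ring|].
  apply conv_unit_disk_scal, conv_unit_disk_euler, IH.
Qed.

(** * Power series in y = p^x: derivatives and complete monotonicity *)

Lemma ln_unit_neg p : 0 < p < 1 -> ln p < 0.
Proof. intros Hp; rewrite <- ln_1; now apply ln_increasing. Qed.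

Lemma Rpower_unit p x : 0 < p < 1 -> 0 < x -> 0 < Rpower p x < 1.
Proof.
intros Hp Hx; split; [apply exp_pos|].
unfold Rpower; rewrite <- exp_0; apply exp_increasing.
pose proof (ln_unit_neg p Hp); nra.
Qed.

Lemma Rabs_Rpower_unit p x : 0 < p < 1 -> 0 < x -> Rabs (Rpower p x) < 1.
Proof.
intros Hp Hx; destruct (Rpower_unit p x Hp Hx); rewrite Rabs_pos_eq; lra.
Qed.

Lemma is_derive_PSeries_Rpower a p x :
  conv_unit_disk a -> 0 < p < 1 -> 0 < x ->
  is_derive (fun t => PSeries a (Rpower p t)) x
    (ln p * PSeries (fun n => INR n * a n) (Rpower p x)).
Proof.
intros Ha Hp Hx.
rewrite <- (PSeries_ext _ _ _ (euler_PS a)).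
rewrite PSeries_incr_1.
replace (ln p * _) with
  (ln p * Rpower p x * PSeries (PS_derive a) (Rpower p x)) by ring.
apply (is_derive_comp (PSeries a) (Rpower p)).
- apply is_derive_PSeries, conv_unit_disk_radius; [exact Ha|].
  now apply Rabs_Rpower_unit.
- unfold Rpower; auto_derive; [exact I|ring].
Qed.

Lemma locally_pos (P : R -> Prop) x :
  0 < x -> (forall t, 0 < t -> P t) -> locally x P.
Proof.
intros Hx H; apply (filter_imp (fun t => 0 < t)); [exact H|].
apply (open_gt 0 x Hx).
Qed.

Lemma is_derive_n_PSeries_Rpower f a p :
  conv_unit_disk a -> 0 < p < 1 ->
  (forall x, 0 < x -> f x = PSeries a (Rpower p x)) ->
  forall k x, 0 < x ->
  is_derive_n f k x (PSeries (fun n => (ln p * INR n) ^ k * a n) (Rpower p x)).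
Proof.
intros Ha Hp Hf k; induction k as [|k IH]; intros x Hx.
- simpl; rewrite Hf by exact Hx; apply PSeries_ext; intros n; ring.
- simpl.
  apply (is_derive_ext_loc
    (fun t => PSeries (fun n => (ln p * INR n) ^ k * a n) (Rpower p t))).
  + apply locally_pos; [exact Hx|]; intros t Ht.
    symmetry; apply is_derive_n_unique, IH, Ht.
  + rewrite (PSeries_ext _
      (PS_scal (ln p) (fun n => INR n * ((ln p * INR n) ^ k * a n)))).
    2: { intros n; unfold PS_scal, scal; simpl; unfold mult; simpl; ring. }
    rewrite PSeries_scal.
    apply is_derive_PSeries_Rpower; trivial.
    now apply conv_unit_disk_euler_pow.
Qed.

(** Each differentiation in x multiplies the coefficient of y^n by n ln p, which is at most 0. The
    sign (-1)^k therefore leaves the factor (- n ln p)^k, and every term of the series is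
    nonnegative. *)
Lemma completely_monotonic_PSeries_Rpower f a p :
  conv_unit_disk a -> 0 < p < 1 -> (forall n, 0 <= a n) ->
  (forall x, 0 < x -> f x = PSeries a (Rpower p x)) ->
  completely_monotonic 0 p_infty f.
Proof.
intros Ha Hp Hpos Hf k x Hx _; simpl in Hx.
pose proof (is_derive_n_PSeries_Rpower f a p Ha Hp Hf) as HD.
split.
- destruct k; [exact I|].
  eexists; exact (HD (S k) x Hx).
- rewrite (is_derive_n_unique _ _ _ _ (HD k x Hx)).
  rewrite <- PSeries_scal.
  assert (Hl : 0 < - ln p) by (pose proof (ln_unit_neg p Hp); lra).
  assert (Hex : ex_series (fun n => ((- ln p * INR n) ^ k * a n) * Rpower p x ^ n)).
  { destruct (conv_unit_disk_euler_pow (- ln p) k a Ha (Rpower p x)) as [l Hl'].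
    - now apply Rabs_Rpower_unit.
    - exists l; now apply is_pseries_R. }
  rewrite (PSeries_ext _ (fun n => (- ln p * INR n) ^ k * a n)).
  2: { intros n; unfold PS_scal, scal; simpl; unfold mult; simpl.
       rewrite <- Rmult_assoc, <- Rpow_mult_distr; f_equal; f_equal; ring. }
  unfold PSeries.
  replace 0 with (Series (fun n => 0 * 0)) by (rewrite Series_scal_l; ring).
  apply Series_le; [|exact Hex].
  intros n; split; [lra|].
  rewrite Rmult_0_l; repeat apply Rmult_le_pos; trivial.
  + apply pow_le, Rmult_le_pos; [lra|apply pos_INR].
  + apply pow_le; left; now apply Rpower_unit.
Qed.

(** * Logarithms of the infinite products as power series *)

Lemma conv_unit_disk_inv_nat : conv_unit_disk (fun n => / INR n).
Proof.
apply conv_unit_disk_bounded with 1; intros [|n].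
- simpl; rewrite Rinv_0, Rabs_R0; lra.
- assert (H : 1 <= INR (S n)) by (rewrite S_INR; pose proof (pos_INR n); lra).
  rewrite Rabs_pos_eq.
  + rewrite <- Rinv_1; apply Rinv_le_contravar; lra.
  + left; apply Rinv_0_lt_compat; lra.
Qed.

(** The derivative of the series is the geometric series 1 / (1 - t), so the difference [f] of the
    two sides has derivative 0; it also vanishes at 0. *)
Lemma PSeries_inv_nat y : 0 <= y < 1 -> PSeries (fun n => / INR n) y = - ln (1 - y).
Proof.
intros Hy.
set (f := fun t => PSeries (fun n => / INR n) t + ln (1 - t)).
assert (Hd : forall t, 0 <= t < 1 -> is_derive f t 0).
{ intros t Ht.
  assert (Habs : Rabs t < 1) by (rewrite Rabs_pos_eq; lra).
  replace 0 with (plus (/ (1 - t)) (- / (1 - t))) by (unfold plus; simpl; ring).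
  apply (is_derive_plus (PSeries (fun n => / INR n)) (fun t => ln (1 - t))).
  - rewrite <- Series_geom by exact Habs.
    replace (Series _) with (PSeries (PS_derive (fun n => / INR n)) t).
    + apply is_derive_PSeries, conv_unit_disk_radius; [apply conv_unit_disk_inv_nat|exact Habs].
    + apply Series_ext; intros n; unfold PS_derive; rewrite Rinv_r; [ring|].
      apply not_0_INR; lia.
  - auto_derive; [lra|field; lra]. }
destruct (MVT_gen f 0 y (fun _ => 0)) as [c [_ Hc]].
- rewrite Rmin_left, Rmax_right by lra; intros t Ht; apply Hd; lra.
- rewrite Rmin_left, Rmax_right by lra; intros t Ht.
  apply continuity_pt_filterlim, (ex_derive_continuous f); exists 0; apply Hd; lra.
- unfold f in Hc at 2; rewrite PSeries_0, Rminus_0_r, ln_1 in Hc.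
  (* The constant coefficient [/ INR 0] is 0 by the convention [/ 0 = 0], hence [f 0 = 0]. *)
  simpl in Hc; rewrite Rinv_0 in Hc; unfold f in Hc; lra.
Qed.

(* Since [/ 0 = 0], the coefficient of index [0] vanishes. *)
Definition q_coef (p : R) (n : nat) : R := / (1 - p ^ n).

Lemma q_coef_0 p : q_coef p 0 = 0.
Proof. unfold q_coef; simpl; rewrite Rminus_diag; apply Rinv_0. Qed.

Lemma pow_unit_le_1 p n : 0 < p < 1 -> 0 < p ^ n <= 1.
Proof.
intros Hp; split; [apply pow_lt; lra|].
rewrite <- (pow1 n); apply pow_incr; lra.
Qed.

Lemma pow_pos_le_base p n : 0 < p < 1 -> (1 <= n)%nat -> 0 < p ^ n <= p.
Proof.
intros Hp Hn; destruct n as [|n]; [lia|]; clear Hn.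
pose proof (pow_unit_le_1 p n Hp).
simpl; nra.
Qed.

Lemma q_coef_pos p n : 0 < p < 1 -> (1 <= n)%nat -> 0 < q_coef p n.
Proof.
intros Hp Hn; apply Rinv_0_lt_compat; pose proof (pow_pos_le_base p n Hp Hn); lra.
Qed.

Lemma conv_unit_disk_q_coef p : 0 < p < 1 -> conv_unit_disk (q_coef p).
Proof.
intros Hp; apply conv_unit_disk_bounded with (/ (1 - p)); intros [|n].
- rewrite q_coef_0, Rabs_R0; left; apply Rinv_0_lt_compat; lra.
- rewrite Rabs_pos_eq; [|left; apply q_coef_pos; [exact Hp|lia]].
  pose proof (pow_pos_le_base p (S n) Hp ltac:(lia)).
  apply Rinv_le_contravar; lra.
Qed.

Lemma conv_unit_disk_pow_q_coef p k :
  0 < p < 1 -> conv_unit_disk (fun n => INR n ^ k * q_coef p n).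
Proof.
intros Hp; apply conv_unit_disk_ext with (fun n => (1 * INR n) ^ k * q_coef p n).
- intros n; now rewrite Rmult_1_l.
- apply conv_unit_disk_euler_pow, conv_unit_disk_q_coef, Hp.
Qed.

(** Coefficients of the series T of the overview. The Euler operator turns them into [q_coef], at
    index 0 as well since [q_coef p 0 = 0]. *)
Definition log_q_coef (p : R) (n : nat) : R := / INR n * q_coef p n.

Lemma conv_unit_disk_log_q_coef p : 0 < p < 1 -> conv_unit_disk (log_q_coef p).
Proof.
intros Hp; apply conv_unit_disk_bounded with (/ (1 - p)); intros [|n].
- unfold log_q_coef; rewrite q_coef_0, Rmult_0_r, Rabs_R0.
  left; apply Rinv_0_lt_compat; lra.
- pose proof (pow_pos_le_base p (S n) Hp ltac:(lia)) as Hpn.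
  pose proof (q_coef_pos p (S n) Hp ltac:(lia)) as Hc.
  assert (Hle : q_coef p (S n) <= / (1 - p)) by (apply Rinv_le_contravar; lra).
  assert (H : 1 <= INR (S n)) by (rewrite S_INR; pose proof (pos_INR n); lra).
  assert (Hi : 0 < / INR (S n) <= 1).
  { split; [apply Rinv_0_lt_compat; lra|].
    rewrite <- Rinv_1; apply Rinv_le_contravar; lra. }
  unfold log_q_coef; rewrite Rabs_pos_eq; nra.
Qed.

(** The factor p^n - 1 coming from the difference cancels the denominator 1 - p^n, which leaves the
    coefficients - 1/n of ln (1 - y). *)
Lemma PSeries_log_q_coef_step p y :
  0 < p < 1 -> 0 <= y < 1 ->
  ln (1 - y) = PSeries (log_q_coef p) (p * y) - PSeries (log_q_coef p) y.
Proof.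
intros Hp Hy.
assert (Hex : forall z, 0 <= z < 1 -> ex_series (fun n => log_q_coef p n * z ^ n)).
{ intros z Hz; destruct (conv_unit_disk_log_q_coef p Hp z) as [l Hl].
  - rewrite Rabs_pos_eq; lra.
  - exists l; now apply is_pseries_R. }
unfold PSeries; rewrite <- Series_minus by (apply Hex; nra).
enough (ln (1 - y) = - PSeries (fun n => / INR n) y) as ->.
2: { rewrite PSeries_inv_nat by exact Hy; ring. }
unfold PSeries; rewrite <- Series_opp; apply Series_ext; intros n.
rewrite Rpow_mult_distr; unfold log_q_coef, q_coef; destruct n as [|n].
- simpl; rewrite Rinv_0; ring.
- pose proof (pow_pos_le_base p (S n) Hp ltac:(lia)).
  field; split; [lra|apply not_0_INR; lia].
Qed.

(* The functional equation [T (p y) - T y = ln (1 - y)] of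
   [T y = sum y^n / (n (1 - p^n))] makes the partial sums telescope. *)
Lemma is_series_ln_q_factors p y :
  0 < p < 1 -> 0 < y < 1 ->
  is_series (fun n => ln (1 - p ^ n * y)) (- PSeries (log_q_coef p) y).
Proof.
intros Hp Hy.
set (T := PSeries (log_q_coef p)).
assert (Hpn := fun n => pow_unit_le_1 p n Hp).
assert (Hs : forall N, sum_n (fun n => ln (1 - p ^ n * y)) N = T (p ^ S N * y) - T y).
{ induction N as [|N IH].
  - rewrite sum_O, PSeries_log_q_coef_step with (p := p); [|exact Hp|simpl; lra].
    unfold T; simpl; rewrite Rmult_1_r, Rmult_1_l; reflexivity.
  - rewrite sum_Sn, IH, PSeries_log_q_coef_step with (p := p) (y := p ^ S N * y).
    + unfold plus; simpl; fold T.
      replace (p * (p * p ^ N) * y) with (p * (p * p ^ N * y)) by ring; ring.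
    + exact Hp.
    + pose proof (Hpn (S N)); nra. }
assert (HL : is_lim_seq (fun N => T (p ^ S N * y) - T y) (T 0 - T y)).
{ apply is_lim_seq_minus'; [|apply is_lim_seq_const].
  apply is_lim_seq_continuous.
  - apply PSeries_continuity, conv_unit_disk_radius.
    + now apply conv_unit_disk_log_q_coef.
    + rewrite Rabs_R0; lra.
  - replace (Finite 0) with (Rbar_mult 0 y) by (simpl; f_equal; ring).
    apply is_lim_seq_scal_r.
    apply (is_lim_seq_incr_1 (fun n => p ^ n)).
    apply is_lim_seq_geom; rewrite Rabs_pos_eq; lra. }
assert (HT0 : T 0 = 0).
{ unfold T; rewrite PSeries_0; unfold log_q_coef; rewrite q_coef_0; ring. }
rewrite HT0, Rminus_0_l in HL.
apply (is_lim_seq_ext _ _ _ (fun N => eq_sym (Hs N)) HL).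
Qed.

(** Positive factors make each partial product the exponential of a partial sum, and [exp] is
    continuous. The value of [Lim_seq] is thus a true limit here, not a conventional one. *)
Lemma infinite_prod_exp u (l : R) :
  (forall n, 0 < u n) -> is_series (fun n => ln (u n)) l -> infinite_prod u = exp l.
Proof.
intros Hu Hl; unfold infinite_prod.
assert (Hp : forall N, prod_f_R0 u N = exp (sum_n (fun n => ln (u n)) N)).
{ induction N as [|N IH].
  - rewrite sum_O; simpl; now rewrite exp_ln.
  - rewrite sum_Sn; simpl; rewrite IH; unfold plus; simpl.
    now rewrite exp_plus, (exp_ln (u (S N))). }
replace (Lim_seq _) with (Finite (exp l)); [reflexivity|].
symmetry; apply is_lim_seq_unique.
apply (is_lim_seq_ext _ _ (exp l) (fun N => eq_sym (Hp N))).
apply is_lim_seq_continuous; [|exact Hl].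
apply derivable_continuous_pt, derivable_pt_exp.
Qed.

(** Numerators and denominators are the factors 1 - p^n y at y = p and at y = p^x;
    [is_series_ln_q_factors] sums both logarithms. *)
Lemma infinite_prod_q_ratio p x :
  0 < p < 1 -> 0 < x ->
  infinite_prod (fun n => (1 - Rpower p (INR n + 1)) / (1 - Rpower p (INR n + x))) =
  exp (PSeries (log_q_coef p) (Rpower p x) - PSeries (log_q_coef p) p).
Proof.
intros Hp Hx.
assert (Hpow : forall n t, Rpower p (INR n + t) = p ^ n * Rpower p t).
{ intros n t; rewrite Rpower_plus, Rpower_pow; lra. }
assert (Hunit : forall n t, 0 < t -> 0 < 1 - Rpower p (INR n + t)).
{ intros n t Ht; pose proof (pos_INR n).
  pose proof (Rpower_unit p (INR n + t) Hp ltac:(lra)); lra. }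
apply infinite_prod_exp.
- intros n; apply Rdiv_lt_0_compat; apply Hunit; lra.
- assert (H1 := is_series_ln_q_factors p p Hp Hp).
  assert (H2 := is_series_ln_q_factors p (Rpower p x) Hp (Rpower_unit p x Hp Hx)).
  assert (H := is_series_minus _ _ _ _ H1 H2).
  replace (PSeries _ _ - _) with
    (minus (- PSeries (log_q_coef p) p) (- PSeries (log_q_coef p) (Rpower p x)))
    by (unfold minus, plus, opp; simpl; ring).
  eapply is_series_ext; [|exact H]; intros n.
  unfold minus, plus, opp; simpl.
  rewrite ln_div by (apply Hunit; lra).
  rewrite !Hpow, Rpower_1 by lra; ring.
Qed.

(** * Expansions of [ln (q_Gamma q x)] and of the derivatives of [q_psi] *)

Definition q_base (q : R) : R := if Rlt_dec q 1 then q else / q.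

Lemma q_base_unit q : 0 < q -> q <> 1 -> 0 < q_base q < 1.
Proof.
intros Hq Hq1; unfold q_base; destruct (Rlt_dec q 1); [lra|].
split; [apply Rinv_0_lt_compat; lra|].
rewrite <- Rinv_1; apply Rinv_lt_contravar; lra.
Qed.

(** The prefactor q^(x (x - 1) / 2), present only for q > 1, contributes this constant to the first
    derivative of [q_psi]. *)
Definition q_quad (q : R) : R := if Rlt_dec q 1 then 0 else ln q.

(** The affine part may stay unspecified: [c] disappears in [q_psi] and [b] in its first
    derivative. *)
Lemma ln_q_Gamma q :
  0 < q -> q <> 1 ->
  exists b c, forall x, 0 < x ->
    ln (q_Gamma q x) = / 2 * q_quad q * x ^ 2 + b * x + c
      + PSeries (log_q_coef (q_base q)) (Rpower (q_base q) x).
Proof.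
intros Hq Hq1.
pose proof (q_base_unit q Hq Hq1) as Hp.
unfold q_Gamma, q_quad; revert Hp; unfold q_base.
destruct (Rlt_dec q 1) as [Hlt|Hge]; intros Hp.
- set (T := PSeries (log_q_coef q) q).
  exists (- ln (1 - q)), (ln (1 - q) - T); intros x Hx.
  rewrite infinite_prod_q_ratio by assumption; fold T.
  unfold Rpower at 1; rewrite <- exp_plus, ln_exp; ring.
- set (T := PSeries (log_q_coef (/ q)) (/ q)).
  exists (- ln (q - 1) - / 2 * ln q), (ln (q - 1) - T); intros x Hx.
  (* Since q^(-t) = (1/q)^t, the product for q > 1 is the one for q < 1 taken at base 1/q. *)
  assert (E : infinite_prod (fun n =>
      (1 - Rpower q (- (INR n + 1))) / (1 - Rpower q (- (INR n + x)))) =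
    infinite_prod (fun n =>
      (1 - Rpower (/ q) (INR n + 1)) / (1 - Rpower (/ q) (INR n + x)))).
  { assert (Er : forall t, Rpower q (- t) = Rpower (/ q) t).
    { intros t; unfold Rpower; rewrite ln_Rinv by exact Hq; f_equal; ring. }
    unfold infinite_prod; f_equal; apply Lim_seq_ext; intros N.
    induction N as [|N IH]; simpl; [|rewrite IH]; now rewrite !Er. }
  rewrite E, infinite_prod_q_ratio by assumption; fold T.
  unfold Rpower at 1 2; rewrite <- !exp_plus, ln_exp; field.
Qed.

(** The order starts at 1, where the affine part of [ln_q_Gamma] is gone. The quadratic term leaves
    a constant at order 1 and nothing beyond. *)
Lemma Derive_n_q_psi q m x :
  0 < q -> q <> 1 -> 0 < x ->
  Derive_n (q_psi q) (S m) x =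
    (if m then q_quad q else 0)
    + ln (q_base q) ^ S (S m)
      * PSeries (fun n => INR n ^ S m * q_coef (q_base q) n) (Rpower (q_base q) x).
Proof.
intros Hq Hq1.
pose proof (q_base_unit q Hq Hq1) as Hp.
destruct (ln_q_Gamma q Hq Hq1) as [b [c Hln]].
set (p := q_base q) in *.
assert (Hpsi : forall t, 0 < t -> q_psi q t =
    q_quad q * t + b + ln p * PSeries (q_coef p) (Rpower p t)).
{ intros t Ht; unfold q_psi; apply is_derive_unique.
  apply (is_derive_ext_loc (fun s => / 2 * q_quad q * s ^ 2 + b * s + c
    + PSeries (log_q_coef p) (Rpower p s))).
  { apply locally_pos; [exact Ht|]; intros s Hs; symmetry; now apply Hln. }
  apply (is_derive_plus (fun s => / 2 * q_quad q * s ^ 2 + b * s + c)).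
  - auto_derive; [exact I|simpl; field].
  - rewrite (PSeries_ext (q_coef p) (fun n => INR n * log_q_coef p n)).
    + apply is_derive_PSeries_Rpower; [now apply conv_unit_disk_log_q_coef|exact Hp|exact Ht].
    + intros [|n]; unfold log_q_coef.
      * rewrite q_coef_0; ring.
      * field; apply not_0_INR; lia. }
assert (Hconv := fun k => conv_unit_disk_pow_q_coef p k Hp).
assert (Hstep : forall k t, 0 < t ->
  is_derive (fun s => ln p ^ S k * PSeries (fun n => INR n ^ k * q_coef p n) (Rpower p s)) t
   (ln p ^ S (S k) * PSeries (fun n => INR n ^ S k * q_coef p n) (Rpower p t))).
{ intros k t Ht.
  rewrite (PSeries_ext (fun n => INR n ^ S k * _)
    (fun n => INR n * (INR n ^ k * q_coef p n))) by (intros n; simpl; ring).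
  replace (ln p ^ S (S k) * _) with (ln p ^ S k *
    (ln p * PSeries (fun n => INR n * (INR n ^ k * q_coef p n)) (Rpower p t)))
    by (simpl; ring).
  apply is_derive_scal.
  apply is_derive_PSeries_Rpower; [apply Hconv|exact Hp|exact Ht]. }
revert x; induction m as [|m IH]; intros x Hx; apply is_derive_unique.
- apply (is_derive_ext_loc (fun t => (q_quad q * t + b)
    + ln p ^ 1 * PSeries (fun n => INR n ^ 0 * q_coef p n) (Rpower p t))).
  { apply locally_pos; [exact Hx|]; intros t Ht; simpl; rewrite Hpsi by exact Ht.
    rewrite (PSeries_ext (fun n => 1 * _) (q_coef p)) by (intros n; ring); ring. }
  apply (is_derive_plus (fun t => q_quad q * t + b)); [|apply Hstep, Hx].
  auto_derive; [exact I|ring].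
- apply (is_derive_ext_loc (fun t => (if m then q_quad q else 0) + ln p ^ S (S m)
    * PSeries (fun n => INR n ^ S m * q_coef p n) (Rpower p t))).
  { apply locally_pos; [exact Hx|]; intros t Ht; symmetry; now apply IH. }
  apply (is_derive_plus (fun _ => if m then q_quad q else 0)); [|apply Hstep, Hx].
  apply is_derive_Reals, derivable_pt_lim_const.
Qed.

(** * Inequalities that make the coefficients nonnegative *)

(** Clearing denominators leaves [0 <= g a]. Here [g 0 = 0], and g'(t) = 1 - (t + 1) exp (-t) is
    nonnegative because exp t >= 1 + t. *)
Lemma inv_1_minus_exp_ge a : 0 < a -> / a + / 2 <= / (1 - exp (- a)).
Proof.
intros Ha.
set (g := fun t => (t - 2) + (t + 2) * exp (- t)).
assert (Hg : 0 <= g a).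
{ destruct (MVT_gen g 0 a (fun t => 1 - (t + 1) * exp (- t))) as [c [Hc E]].
  - intros t _; unfold g; auto_derive; [exact I|ring].
  - intros t _; apply continuity_pt_filterlim, (ex_derive_continuous g).
    unfold g; auto_derive; exact I.
  - rewrite Rmin_left, Rmax_right in Hc by lra.
    assert (H0 : g 0 = 0) by (unfold g; rewrite Ropp_0, exp_0; ring).
    assert (He : (c + 1) * exp (- c) <= 1).
    { rewrite exp_Ropp; apply Rmult_le_reg_r with (exp c); [apply exp_pos|].
      rewrite Rmult_assoc, Rinv_l by (apply Rgt_not_eq, exp_pos).
      pose proof (exp_ineq1_le c); lra. }
    nra. }
assert (He : exp (- a) < 1) by (rewrite <- exp_0; apply exp_increasing; lra).
unfold g in Hg; pose proof (exp_pos (- a)).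
replace (/ a + / 2) with ((a + 2) / (2 * a)) by (field; lra).
apply Rmult_le_reg_r with (2 * a * (1 - exp (- a))); [nra|].
field_simplify; lra.
Qed.

(* With [X = p^i] and [Y = p^j], [(1 - X Y) / ((1 - X) (1 - Y))] equals
   [1 / (1 - X) + 1 / (1 - Y) - 1], which is at least [1 / (i L) + 1 / (j L)]
   for [L = - ln p]. *)
Lemma q_coef_convolution_term p i j :
  0 < p < 1 -> (1 <= i)%nat -> (1 <= j)%nat ->
  INR (i + j) * q_coef p (i + j) <=
  - ln p * (INR i * q_coef p i) * (INR j * q_coef p j).
Proof.
intros Hp Hi Hj.
set (L := - ln p).
assert (HL : 0 < L) by (pose proof (ln_unit_neg p Hp); unfold L; lra).
assert (Hlow : forall n, (1 <= n)%nat -> / (INR n * L) + / 2 <= q_coef p n).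
{ intros n Hn; unfold q_coef.
  replace (p ^ n) with (exp (- (INR n * L))).
  - apply inv_1_minus_exp_ge, Rmult_lt_0_compat; [apply lt_0_INR; lia|exact HL].
  - rewrite <- Rpower_pow by lra; unfold Rpower, L; f_equal; ring. }
assert (HI : 0 < INR i) by (apply lt_0_INR; lia).
assert (HJ : 0 < INR j) by (apply lt_0_INR; lia).
pose proof (pow_pos_le_base p i Hp Hi); pose proof (pow_pos_le_base p j Hp Hj).
pose proof (pow_pos_le_base p (i + j) Hp ltac:(lia)).
assert (Hsplit : q_coef p i * q_coef p j =
  q_coef p (i + j) * (q_coef p i + q_coef p j - 1)).
{ unfold q_coef; rewrite pow_add in *; field; lra. }
pose proof (q_coef_pos p (i + j) Hp ltac:(lia)) as Hc.
replace (L * _ * _) with (q_coef p (i + j) *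
  (L * INR i * INR j * (q_coef p i + q_coef p j - 1)))
  by (transitivity (L * INR i * INR j * (q_coef p i * q_coef p j)); [rewrite Hsplit|]; ring).
rewrite Rmult_comm; apply Rmult_le_compat_l; [lra|].
rewrite plus_INR.
replace (INR i + INR j) with (L * INR i * INR j * (/ (INR i * L) + / (INR j * L)))
  by (field; lra).
apply Rmult_le_compat_l; [repeat apply Rmult_le_pos; lra|].
(* The two terms 1/2 of the lower bounds absorb the -1. *)
pose proof (Hlow i Hi); pose proof (Hlow j Hj); lra.
Qed.

(** This is e = max (r, 1) of the overview; for q < 1 it equals [d_coef (S r) q]. *)
Definition shift_coef (r : nat) : R := match r with O => 1 | S _ => INR r end.

(** Bernoulli's inequality (1 - t)^(r+1) >= 1 - (r+1) t at t = 1/(n+2), cleared of denominators. In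
    the induction, n+1 times the old left side exceeds the new one by (r+1) (n+2)^r. *)
Lemma pow_succ_bernoulli n r :
  (INR n + 2) ^ r * (INR n + 1 - INR r) <= (INR n + 1) ^ S r.
Proof.
induction r as [|r IH]; [simpl; lra|].
pose proof (pos_INR n) as Hn; pose proof (pos_INR r) as Hr.
assert (Hpow : 0 <= (INR n + 2) ^ r) by (apply pow_le; lra).
apply Rle_trans with ((INR n + 1) * ((INR n + 2) ^ r * (INR n + 1 - INR r))).
- rewrite S_INR; simpl.
  replace ((INR n + 2) * (INR n + 2) ^ r * (INR n + 1 - (INR r + 1)))
    with ((INR n + 2) ^ r * ((INR n + 2) * (INR n - INR r))) by ring.
  replace ((INR n + 1) * ((INR n + 2) ^ r * (INR n + 1 - INR r)))
    with ((INR n + 2) ^ r * ((INR n + 1) * (INR n + 1 - INR r))) by ring.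
  apply Rmult_le_compat_l; [exact Hpow|nra].
- change ((INR n + 1) ^ S (S r)) with ((INR n + 1) * (INR n + 1) ^ S r).
  apply Rmult_le_compat_l; [lra|exact IH].
Qed.

(** From [n] to [S n] the left side grows by at most (r+1) (n+1)^r, the growth of the right side.
    For r > 0 this is [pow_succ_bernoulli] at exponent r-1, multiplied by n+2. The guard at index 0
    keeps [0 ^ 0 = 1] out of the sum when r = 0. *)
Lemma sum_pow_ge r n :
  INR (S n) ^ r * (INR (S n) - shift_coef r) <=
  INR (S r) * sum_f_R0 (fun j => if j then 0 else INR j ^ r) n.
Proof.
induction n as [|n IH].
- simpl sum_f_R0; rewrite Rmult_0_r.
  change (INR 1) with 1; rewrite pow1; destruct r as [|r]; [simpl; lra|].
  unfold shift_coef; rewrite S_INR; pose proof (pos_INR r); lra.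
- rewrite tech5, Rmult_plus_distr_l.
  apply Rplus_le_reg_r with (- (INR (S n) ^ r * (INR (S n) - shift_coef r))).
  match goal with |- ?l <= _ => apply Rle_trans with (INR (S r) * INR (S n) ^ r) end; [|lra].
  destruct r as [|r]; [rewrite !S_INR; simpl; lra|].
  unfold shift_coef.
  pose proof (pow_succ_bernoulli n r) as H.
  pose proof (pos_INR n).
  rewrite !S_INR.
  replace (INR n + 1 + 1) with (INR n + 2) by ring.
  apply Rmult_le_compat_l with (r := INR n + 2) in H; [|lra].
  simpl in *; lra.
Qed.

(** The coefficient described in the overview, with m = r+1 and without the common factor
    L^(r+3). *)
Definition monotonic_coef (p : R) (r n : nat) : R :=
  INR (S r) * - ln p
    * PS_mult (fun j => INR j ^ S r * q_coef p j) (fun j => INR j ^ 1 * q_coef p j) n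
  + (shift_coef r * (INR n ^ S r * q_coef p n) + -1 * (INR n ^ S (S r) * q_coef p n)).

(** Both end terms of the convolution vanish since c_0 = 0. The inner ones are bounded below by
    [q_coef_convolution_term] weighted with j^r, which leaves N c_N times the power sum estimated in
    [sum_pow_ge]. *)
Lemma monotonic_coef_nonneg p r n : 0 < p < 1 -> 0 <= monotonic_coef p r n.
Proof.
intros Hp; unfold monotonic_coef, PS_mult; destruct n as [|n].
- simpl; rewrite q_coef_0; lra.
- set (N := S n).
  assert (Hlast : forall f, sum_f_R0 f N = sum_f_R0 f n + f N) by (intros f; apply tech5).
  rewrite Hlast, Nat.sub_diag, q_coef_0, !Rmult_0_r, Rplus_0_r.
  assert (Hs : INR N * q_coef p N * sum_f_R0 (fun j => if j then 0 else INR j ^ r) n <=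
    - ln p * sum_f_R0 (fun j => INR j ^ S r * q_coef p j
        * (INR (N - j) ^ 1 * q_coef p (N - j))) n).
  { rewrite !scal_sum; apply sum_Rle; intros [|j] Hj.
    - simpl; rewrite q_coef_0; lra.
    - pose proof (q_coef_convolution_term p (S j) (N - S j) Hp ltac:(lia) ltac:(lia)) as H.
      replace (S j + (N - S j))%nat with N in H by lia.
      apply Rmult_le_compat_l with (r := INR (S j) ^ r) in H; [|apply pow_le, pos_INR].
      replace (INR (S j) ^ S r) with (INR (S j) * INR (S j) ^ r) by reflexivity.
      rewrite pow_1; lra. }
  pose proof (sum_pow_ge r n) as Hc; fold N in Hc.
  assert (HN : 0 <= INR N * q_coef p N).
  { left; apply Rmult_lt_0_compat; [apply lt_0_INR; lia|].
    apply q_coef_pos; [exact Hp|lia]. }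
  apply Rmult_le_compat_l with (1 := HN) in Hc.
  apply Rmult_le_compat_l with (r := INR (S r)) in Hs; [|apply pos_INR].
  replace (INR N ^ S (S r)) with (INR N * INR N * INR N ^ r) by (simpl; ring).
  replace (INR N ^ S r) with (INR N * INR N ^ r) by reflexivity.
  lra.
Qed.

(** * Complete monotonicity from the expansion in powers of p^x *)

Theorem corollary1p1 (q : R) (m : nat) (hq : 0 < q) (hq1 : q <> 1) (hm : (1 <= m)%nat) :
  completely_monotonic 0 p_infty (fun x : R =>
    INR m * (-1) ^ (m + 1) * Derive (q_psi q) x * Derive_n (q_psi q) m x
    + (-1) ^ (m + 1) * Derive_n (q_psi q) (m + 1) x
    - (-1) ^ (m + 1) * d_coef m q * ln q * Derive_n (q_psi q) m x).
Proof.
destruct m as [|r]; [lia|].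
pose proof (q_base_unit q hq hq1) as Hp.
set (p := q_base q) in *.
assert (Hconv := fun k => conv_unit_disk_pow_q_coef p k Hp).
assert (Hmult := conv_unit_disk_mult _ _ (Hconv (S r)) (Hconv 1%nat)).
assert (HL : 0 < - ln p) by (pose proof (ln_unit_neg p Hp); lra).
assert (Hlin := conv_unit_disk_plus _ _ (conv_unit_disk_scal (shift_coef r) _ (Hconv (S r)))
  (conv_unit_disk_scal (-1) _ (Hconv (S (S r))))).
assert (Hmult' := conv_unit_disk_scal (INR (S r) * - ln p) _ Hmult).
assert (Hcoef := conv_unit_disk_plus _ _ Hmult' Hlin).
apply completely_monotonic_PSeries_Rpower with
  (a := fun n => (- ln p) ^ S (S (S r)) * monotonic_coef p r n) (p := p).
- apply conv_unit_disk_scal, Hcoef.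
- exact Hp.
- intros n; apply Rmult_le_pos; [apply pow_le; lra|now apply monotonic_coef_nonneg].
- intros x Hx.
  pose proof (Rabs_Rpower_unit p x Hp Hx) as Hy.
  set (y := Rpower p x) in *.
  (* The Cauchy product and linearity reduce the expansion to an algebraic identity between the
     three sums [A], [A1] and [A2]. *)
  assert (E : PSeries (fun n => (- ln p) ^ S (S (S r)) * monotonic_coef p r n) y =
    (- ln p) ^ S (S (S r)) * (INR (S r) * - ln p *
      (PSeries (fun n => INR n ^ S r * q_coef p n) y
       * PSeries (fun n => INR n ^ 1 * q_coef p n) y)
      + (shift_coef r * PSeries (fun n => INR n ^ S r * q_coef p n) y
         + -1 * PSeries (fun n => INR n ^ S (S r) * q_coef p n) y))).
  { rewrite <- PSeries_mult by (apply conv_unit_disk_radius; [apply Hconv|exact Hy]).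
    rewrite <- !PSeries_scal.
    rewrite <- (PSeries_plus (PS_scal (shift_coef r) _)).
    2, 3: apply (conv_unit_disk_scal _ _ (Hconv _) _ Hy).
    rewrite <- PSeries_plus; [|apply (Hmult' y Hy)|apply (Hlin y Hy)].
    rewrite <- PSeries_scal; reflexivity. }
  rewrite E; clear E Hlin Hmult Hmult' Hcoef Hconv.
  replace (S r + 1)%nat with (S (S r)) by lia.
  change (Derive (q_psi q) x) with (Derive_n (q_psi q) 1 x).
  rewrite !Derive_n_q_psi by assumption; fold p; fold y.
  set (A := PSeries (fun n => INR n ^ S r * q_coef p n) y).
  set (A1 := PSeries (fun n => INR n ^ 1 * q_coef p n) y).
  set (A2 := PSeries (fun n => INR n ^ S (S r) * q_coef p n) y).
  set (L := - ln p); replace (ln p) with (- L) by (unfold L; ring).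
  assert (Hq : q_quad q = 0 /\ ln q = - L /\ d_coef (S r) q = shift_coef r
      \/ q_quad q = L /\ ln q = L /\ d_coef (S r) q = 1).
  { unfold L, p, q_quad, d_coef, q_base; destruct (Rlt_dec q 1).
    - left; repeat split; [ring|].
      destruct r as [|r]; [reflexivity|].
      unfold shift_coef; rewrite (S_INR (S r)); simpl (2 <=? _)%nat; cbv iota; ring.
    - right; rewrite ln_Rinv by exact hq; repeat split; ring. }
  (* For m = 1 the constant [q_quad q] occurs in both factors of the product, and for q > 1 its
     square cancels against the term with [ln q]. For m >= 2 it occurs only in the first derivative
     and turns the coefficient 1 into m - 1. *)
  destruct r as [|r].
  + change A with A1.
    destruct Hq as [[-> [-> ->]]|[-> [-> ->]]]; simpl; ring.
  (* The exponent [r] is symbolic, so all powers are expressed through (-1)^r and (-L)^r; with these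
     as atoms the identity is polynomial. *)
  + assert (Hpow : L ^ r = (-1) ^ r * (- L) ^ r).
    { rewrite <- Rpow_mult_distr; f_equal; ring. }
    assert (HL3 : L ^ S (S (S (S r))) = L ^ 4 * ((-1) ^ r * (- L) ^ r)).
    { rewrite <- Hpow; simpl; ring. }
    rewrite HL3, !(S_INR (S r)); unfold shift_coef in *.
    change ((-1) ^ S (S (S r))) with (-1 * (-1 * (-1 * (-1) ^ r))).
    change ((- L) ^ S (S (S (S r)))) with (- L * (- L * (- L * (- L * (- L) ^ r)))).
    change ((- L) ^ S (S (S r))) with (- L * (- L * (- L * (- L) ^ r))).
    generalize ((-1) ^ r) ((- L) ^ r); intros u v.
    destruct Hq as [[-> [-> ->]]|[-> [-> ->]]]; ring.
Qed.
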